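(* For all $n,\gamma\in\mathbb{N}$, any integer $0\le d\le n$, any nodes $a=x_0<x_1<\dots<x_n=b$ and any $f:[a,b]\to\mathbb{R}$, the generalized Floater--Hormann function satisfies $$\tilde r(f,x_k)=f(x_k),\qquad k=0,1,\ldots,n.$$
   Context: $\mathbb{N}=\{1,2,3,\ldots\}$. Given nodes $a=x_0<x_1<\dots<x_n=b$, a function $f:[a,b]\to\mathbb{R}$, an integer $0\le d\le n$ and $\gamma\in\mathbb{N}$, for $i=0,\ldots,n-d$ let $p_i$ be the unique polynomial of degree $\le d$ interpolating $f$ at $x_i,x_{i+1},\ldots,x_{i+d}$, and let $$\tilde\lambda_i(x)=\frac{(-1)^{i\gamma}}{(x-x_i)^\gamma(x-x_{i+1})^\gamma\cdots(x-x_{i+d})^\gamma}.$$ The generalized Floater--Hormann interpolant of $f$ is $$\tilde r(f,x)=\tilde r(x)=\frac{\sum_{i=0}^{n-d}\tilde\lambda_i(x)p_i(x)}{\sum_{i=0}^{n-d}\tilde\lambda_i(x)}.$$ Multiplying numerator and denominator by $(-1)^{\gamma(n-d)}\prod_{k=0}^n(x-x_k)^\gamma$, it is written as $$\tilde r(f,x)=\frac{\sum_{i=0}^{n-d}\tilde\mu_i(x)p_i(x)}{\sum_{i=0}^{n-d}\tilde\mu_i(x)},\qquad \tilde\mu_i(x)=\prod_{k=0}^{i-1}(x-x_k)^\gamma\prod_{k=i+d+1}^n(x_k-x)^\gamma,$$ with empty products equal to $1$; this form defines $\tilde r(f,x)$ also at the nodes. *)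

(* Defs.v *)
From HB Require Import structures.
From mathcomp Require Import all_boot all_order all_algebra.
From mathcomp Require Import classical_sets reals.

Set Implicit Arguments.
Unset Strict Implicit.
Unset Printing Implicit Defensive.

Import Order.TTheory GRing.Theory Num.Theory.
Local Open Scope ring_scope.

(* [size p <= d.+1] says that p has degree at most d. *)
Definition interpolates (R : realType) (n d : nat) (x : 'I_n.+1 -> R)
    (f : R -> R) (i : nat) (p : {poly R}) : Prop :=
  (size p <= d.+1)%N /\
  forall k : 'I_n.+1, (i <= k <= i + d)%N -> p.[x k] = f (x k).

(* For pairwise distinct nodes and i + d <= n exactly one polynomial
   interpolates f at x_i, ..., x_(i + d), so [xget] returns that polynomial;
   its default value 0 plays no role. *)
Definition interp_poly (R : realType) (n d : nat) (x : 'I_n.+1 -> R)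
    (f : R -> R) (i : nat) : {poly R} :=
  xget 0 [set p | interpolates d x f i p]%classic.

Definition fh_mu (R : realType) (n d gamma : nat) (x : 'I_n.+1 -> R)
    (i : nat) (z : R) : R :=
  (\prod_(k < n.+1 | (k < i)%N) (z - x k) ^+ gamma) *
  (\prod_(k < n.+1 | (i + d < k)%N) (x k - z) ^+ gamma).

(* The form of the interpolant in which the weights have been multiplied by
   (-1)^(gamma (n - d)) \prod_k (z - x_k)^gamma; unlike the quotient of the
   singular weights, it also makes sense at the nodes. *)
Definition fh_interpolant (R : realType) (n d gamma : nat)
    (x : 'I_n.+1 -> R) (f : R -> R) (z : R) : R :=
  (\sum_(i < (n - d).+1) fh_mu d gamma x i z * (interp_poly d x f i).[z]) /
  (\sum_(i < (n - d).+1) fh_mu d gamma x i z).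

(* Main.v *)
Require Import Defs.
From HB Require Import structures.
From mathcomp Require Import all_boot all_order all_algebra.
From mathcomp Require Import classical_sets reals.

Set Implicit Arguments.
Unset Strict Implicit.
Unset Printing Implicit Defensive.

Import Order.TTheory GRing.Theory Num.Theory.
Local Open Scope ring_scope.

(* The weights mu_i(x_k) vanish unless x_k is a node of p_i, and are positive
   otherwise; hence r(x_k) is a convex combination of values
   p_i(x_k) = f(x_k). *)

(** At [x k] every summand of the numerator equals its weight times [f (x k)]: either [p_i]
    interpolates there ([interp_polyP]) or the weight vanishes ([fh_mu_eq0]). So [f (x k)] factors
    out, and the remaining quotient is 1 because the sum of the weights is positive
    ([sum_fh_mu_gt0]). *)

Lemma exists_interpolating_poly (F : fieldType) (f : F -> F) (s : seq F) :
  uniq s ->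
  exists p : {poly F}, (size p <= size s)%N /\ {in s, forall y, p.[y] = f y}.
Proof.
elim: s => [_|y s IHs] /=; first by exists 0; rewrite size_poly0.
case/andP=> ys /IHs[p [sp fp]].
pose q : {poly F} := \prod_(z <- s) ('X - z%:P).
have qy : q.[y] != 0 by rewrite -/(root q y) root_prod_XsubC.
(* Newton's step: [q] vanishes on [s] but not at [y], so adding a multiple of it corrects the value
   at [y] and keeps the others. *)
exists (p + ((f y - p.[y]) / q.[y]) *: q); split.
  rewrite (leq_trans (size_polyD _ _)) // geq_max leqW //=.
  by rewrite (leq_trans (size_scale_leq _ _)) // size_prod_XsubC.
move=> z; rewrite inE !hornerE => /predU1P[->|zs].
  by rewrite divfK // addrC subrK.
have /rootP -> : root q z by rewrite root_prod_XsubC.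
by rewrite mulr0 addr0 fp.
Qed.

Section Nodes.

Variables (R : realType) (n d : nat) (x : 'I_n.+1 -> R).
Hypothesis hx : forall i j : 'I_n.+1, (i < j)%N -> x i < x j.

Lemma nodes_inj : injective x.
Proof.
move=> i j eq_x; apply: val_inj; apply/eqP.
by case: ltngtP => // /hx; rewrite eq_x ltxx.
Qed.

(** [xget] returns a member of any inhabited set, so it suffices to exhibit one interpolating
    polynomial. *)
Lemma interp_polyP (f : R -> R) (i : nat) :
  interpolates d x f i (interp_poly d x f i).
Proof.
pose ks := [seq k : 'I_n.+1 <- enum 'I_n.+1 | (i <= k <= i + d)%N].
have uks : uniq ks by rewrite filter_uniq ?enum_uniq.
have sks : (size ks <= d.+1)%N.
  (* The selected indices are distinct members of i, ..., i + d; there may be fewer than [d.+1] of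
     them, since i + d may exceed n. *)
  rewrite -(size_map val) -[leqRHS](size_iota i); apply: uniq_leq_size.
    by rewrite map_inj_uniq //; apply: val_inj.
  by move=> _ /mapP[k + ->]; rewrite mem_filter mem_iota addnS ltnS => /andP[].
have [|p [sp fp]] := @exists_interpolating_poly _ f (map x ks).
  by rewrite map_inj_uniq //; apply: nodes_inj.
apply: (@xgetPex _ 0 [set p | interpolates d x f i p]%classic).
exists p; split; first by rewrite (leq_trans sp) ?size_map.
by move=> k ik; rewrite fp // map_f // mem_filter ik mem_enum.
Qed.

(** An index outside the window i, ..., i + d occurs in one of the two products, where its factor is
    [0 ^+ gamma]. *)
Lemma fh_mu_eq0 (gamma i : nat) (k : 'I_n.+1) :
  (0 < gamma)%N -> ~~ (i <= k <= i + d)%N -> fh_mu d gamma x i (x k) = 0.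
Proof.
move=> gamma_gt0; rewrite negb_and -!ltnNge /fh_mu => /orP[ki|ik].
  by rewrite (bigD1 k) //= subrr expr0n eqn0Ngt gamma_gt0 !mul0r.
by rewrite [X in _ * X](bigD1 k) //= subrr expr0n eqn0Ngt gamma_gt0 mul0r mulr0.
Qed.

(** The nodes of the first product lie left of [x k] and those of the second lie right of it, so
    every base is positive. *)
Lemma fh_mu_gt0 (gamma i : nat) (k : 'I_n.+1) :
  (i <= k <= i + d)%N -> 0 < fh_mu d gamma x i (x k).
Proof.
case/andP=> ik kid; apply: mulr_gt0; apply: prodr_gt0 => j hj.
  by rewrite exprn_gt0 // subr_gt0 hx // (leq_trans hj).
by rewrite exprn_gt0 // subr_gt0 hx // (leq_ltn_trans kid).
Qed.

Lemma sum_fh_mu_gt0 (gamma : nat) (k : 'I_n.+1) :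
  (0 < gamma)%N -> (d <= n)%N ->
  0 < \sum_(i < (n - d).+1) fh_mu d gamma x i (x k).
Proof.
move=> gamma_gt0 dn.
(* The window starting at min(k, n - d) ends at min(k + d, n), hence contains k; its weight makes
   the sum of nonnegative terms positive. *)
have hi : (minn k (n - d) < (n - d).+1)%N by rewrite ltnS geq_minr.
have mem_i : (Ordinal hi <= k <= Ordinal hi + d)%N.
  by rewrite /= geq_minl addn_minl subnK // leq_min leq_addr -ltnS ltn_ord.
rewrite (bigD1 (Ordinal hi)) //= ltr_wpDr ?fh_mu_gt0 //.
apply: sumr_ge0 => i _.
have [/(fh_mu_gt0 gamma)/ltW //|/(fh_mu_eq0 gamma_gt0) -> //] :=
  boolP (i <= k <= i + d)%N.
Qed.

End Nodes.

Theorem theorem3p4 (R : realType) (n gamma d : nat)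
    (hn : (0 < n)%N) (hgamma : (0 < gamma)%N) (hd : (d <= n)%N)
    (a b : R) (x : 'I_n.+1 -> R)
    (hxa : x ord0 = a) (hxb : x ord_max = b)
    (hx : forall i j : 'I_n.+1, (i < j)%N -> x i < x j)
    (f : R -> R) (k : 'I_n.+1) :
  fh_interpolant d gamma x f (x k) = f (x k).
Proof.
rewrite /fh_interpolant.
under eq_bigr => i _.
  have -> : fh_mu d gamma x i (x k) * (interp_poly d x f i).[x k] =
            fh_mu d gamma x i (x k) * f (x k).
    have [ik|/(fh_mu_eq0 x hgamma) ->] := boolP (i <= k <= i + d)%N.
      by have [_ ->] := interp_polyP d hx f i.
    by rewrite !mul0r.
  over.
by rewrite -mulr_suml mulrAC divff ?mul1r // gt_eqF // sum_fh_mu_gt0.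
Qed.
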